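(* Let $(X,d,\nu)$ be a computable metric space and $\mathcal{Y}\subseteq\mathcal{P}(X)$ a class of subsets of $X$, each zero-dimensional (in the relative topology) or empty, with a representation $\delta_{\mathcal{Y}}:\subseteq\mathbb{B}\to\mathcal{Y}$. Consider the following multi-valued operations. $N:\subseteq\Pi^0_1(X)^2\times\mathcal{Y}\rightrightarrows\Sigma^0_1(X)^2$ with $\operatorname{dom}N=\{(A,B,Y) : A\cap B=\emptyset\}$ and $$N(A,B,Y)=\{(U,V) : A\subseteq U,\ B\subseteq V,\ U\cap V=\emptyset,\ Y\subseteq U\cup V\}.$$ $M:\subseteq X\times\Sigma^0_1(X)\times\mathcal{Y}\rightrightarrows\Sigma^0_1(X)^2$ with $\operatorname{dom}M=\{(x,U,Y) : x\in U\}$ and $$M(x,U,Y)=\{(V,W) : x\in V\subseteq U,\ V\cap W=\emptyset,\ Y\subseteq V\cup W\}.$$ $B:\mathcal{Y}\rightrightarrows(\Sigma^0_1(X)^2)^{\mathbb{N}}\times(\mathbb{N}^2)^{\mathbb{N}}$ (total), where $B(Y)$ is the set of all $((U_i,V_i)_{i\in\mathbb{N}},(a_i,b_i)_{i\in\mathbb{N}})$ such that $(U_i)_i$ is a basis for the topology of $X$, for all $i$ we have $U_i\cap V_i=\emptyset$ and $Y\subseteq U_i\cup V_i$, and the relation $\{(a_k,b_k) : k\in\mathbb{N}\}\subseteq\mathbb{N}^2$ is a refined inclusion of $(U_i)_i$ with respect to $\alpha$. $S:\subseteq\Sigma^0_1(X)^{\mathbb{N}}\times\mathcal{Y}\rightrightarrows\Sigma^0_1(X)^{\mathbb{N}}$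 with $\operatorname{dom}S=\{((V_i)_i,Y) : \bigcup_i V_i\supseteq Y\}$ and $$S((V_i)_i,Y)=\{(W_i)_i : (\forall i)\,W_i\subseteq V_i,\ \textstyle\bigcup_i W_i\supseteq Y,\ (W_i)_i\text{ pairwise disjoint}\}.$$ Consider the conditions: (i) $N$ is computable; (ii) $M$ is computable; (iii) $B$ is computable; (iv) $S$ is computable. Then (i)$\implies$(ii)$\implies$(iii)$\implies$(iv).
   Context: TTE conventions. $\mathbb{B}=\mathbb{N}^{\mathbb{N}}$, $p_i:=p(i)$. $\langle\cdot,\cdot\rangle:\mathbb{N}^2\to\mathbb{N}$ is a standard computable pairing bijection. On $\mathbb{B}$: $\langle p^{(0)},p^{(1)}\rangle(2i+z)=p^{(z)}_i$ ($z\in\{0,1\}$) and $\langle p^{(0)},p^{(1)},\dots\rangle(\langle i,j\rangle)=p^{(i)}_j$. A representation of a set is a partial surjection $\delta:\subseteq\mathbb{B}\to X$; if $\delta(p)=x$, $p$ is a $\delta$-name of $x$. A multi-valued operation $f:\subseteq X\rightrightarrows Y$ assigns to each $x\in\operatorname{dom}f$ a subset $f(x)\subseteq Y$; for representations $\delta,\delta'$ of $X,Y$ it is computable (w.r.t. $\delta,\delta'$) if there is a computable (Type-2 Turing machine computable) $F:\subseteq\mathbb{B}\to\mathbb{B}$ such that whenever $p\in\operatorname{dom}\delta$ and $\delta(p)\in\operatorname{dom}f$, $F(p)$ is defined, $F(p)\in\operatorname{dom}\delta'$ and $\delta'(F(p))\in f(\delta(p))$. Finite products carry $[\delta_1,\delta_2]\langle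 p,q\rangle=(\delta_1(p),\delta_2(q))$ (iterated for more factors), countable powers carry $\delta^{\omega}\langle p^{(0)},p^{(1)},\dots\rangle=(\delta(p^{(i)}))_i$, and $\mathbb{N}$ carries $\delta_{\mathbb{N}}(p)=p_0$. Computable metric space $(X,d,\nu)$: $(X,d)$ is a metric space, $\nu:\mathbb{N}\to X$ is total with dense image, and $(i,j)\mapsto d(\nu(i),\nu(j))$ is a computable double sequence of reals. $X$ carries the Cauchy representation $\delta_X$: $p$ is a name of $x$ iff $\lim_i\nu(p_i)=x$ and $d(\nu(p_i),\nu(p_j))<2^{-\min\{i,j\}}$ for all $i,j$. With $\nu_{\mathbb{Q}^+}$ a standard total numbering of the positive rationals, $\alpha\langle a,r\rangle=B_d(\nu(a);\nu_{\mathbb{Q}^+}(r))$ numbers the ideal open balls. $\Sigma^0_1(X)$ is the class of open sets with $\delta_{\Sigma^0_1}(p)=\bigcup\{\alpha(p_i-1) : i\in\mathbb{N},p_i\geq1\}$; $\Pi^0_1(X)$ is the class of closed sets with $\delta_{\Pi^0_1}(p)=X\setminus\delta_{\Sigma^0_1}(p)$. Zero-dimensional: a nonempty separable metrizable space is zero-dimensional if it has a basis of clopen sets. Refined inclusion: for a family $(U_i)_{i\in\mathbb{N}}$ of open sets forming a basis, a relation $\sqsubset'\subseteq\mathbb{N}^2$ is a refined inclusion of $(U_i)_i$ with respect to $\alpha$ if (a) $a\sqsubset' b\implies U_a\subseteq\alpha(b)$ for all $a,b$, and (b) for all $b\in\mathbb{N}$ and $x\in\alpha(b)$ there is $a$ with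 $x\in U_a$ and $a\sqsubset' b$. *)

(* Defs.v *)
From mathcomp Require Import all_boot all_order all_algebra.
From mathcomp Require Import all_classical all_reals all_analysis.
From Stdlib Require Cantor.

Set Implicit Arguments.
Unset Strict Implicit.
Unset Printing Implicit Defensive.

Import Order.TTheory GRing.Theory Num.Theory.

Local Open Scope classical_set_scope.
Local Open Scope ring_scope.

Definition baire := nat -> nat.

Definition npair (i j : nat) : nat := Cantor.to_nat (i, j).
Definition nfst (n : nat) : nat := (Cantor.of_nat n).1.
Definition nsnd (n : nat) : nat := (Cantor.of_nat n).2.

(** Programs for the partial functions nat -> nat that are partial recursive
    in an oracle: the closure of zero, successor, the two projections of the
    pairing and the oracle itself under pairing, composition, primitive
    recursion and unbounded search. *)
Inductive program : Type :=
| CZero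
| CSucc
| CFst
| CSnd
| COracle
| CPair of program & program
| CComp of program & program
| CPrec of program & program
| CMu of program.

(** [peval p c n m]: program [c] with oracle [p] halts on input [n] with value
    [m]. *)
Fixpoint peval (p : baire) (c : program) (n m : nat) : Prop :=
  match c with
  | CZero => m = 0%N
  | CSucc => m = n.+1
  | CFst => m = nfst n
  | CSnd => m = nsnd n
  | COracle => m = p n
  | CPair f g => exists a b, [/\ peval p f n a, peval p g n b & m = npair a b]
  | CComp f g => exists a, peval p g n a /\ peval p f a m
  (* On [npair a k]: h(a, 0) = f(a), h(a, i+1) = g(a, i, h(a, i)), where [s]
     lists the values h(a, 0), ..., h(a, k). *)
  | CPrec f g => exists s : nat -> nat,
      [/\ peval p f (nfst n) (s 0%N),
          forall i, (i < nsnd n)%N ->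
            peval p g (npair (nfst n) (npair i (s i))) (s i.+1)
        & m = s (nsnd n)]
  (* The least [m] with f(n, m) = 0, where f(n, i) is defined for all i < m. *)
  | CMu f => peval p f (npair n m) 0%N /\
      forall i, (i < m)%N -> exists v, peval p f (npair n i) v.+1
  end.

(** A partial function on Baire space is given by its graph. It is computable
    if a single program, with the argument as oracle, computes each entry of
    the value; the argument is in the domain iff all entries are defined. These
    are the Type-2 computable functions in their oracle-machine formulation. *)
Definition computable_baire (F : baire -> baire -> Prop) : Prop :=
  exists c : program, forall p q, F p q <-> forall n, peval p c n (q n).

(** Ordinary total recursive functions: the constant-zero oracle is
    recursive, so it adds no power. *)
Definition computable_nat (f : nat -> nat) : Prop :=
  exists c : program, forall n, peval (fun=> 0%N) c n (f n).

(** A partial map [baire -> T] is given by its graph: [delta p x] reads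
    "[p] is a [delta]-name of [x]". *)
Definition naming (T : Type) := baire -> T -> Prop.

Definition is_representation (T : Type) (A : set T) (delta : naming T) : Prop :=
  [/\ forall p x y, delta p x -> delta p y -> x = y,
      forall p x, delta p x -> A x
    & forall x, A x -> exists p, delta p x].

Record mvop (S T : Type) := MVOp { mvdom : set S; mvval : S -> set T }.

(** Only arguments and values that have a name are relevant here, so the
    represented sets need not be repeated in the operations below. *)
Definition mv_computable (S T : Type) (delta : naming S) (delta' : naming T)
    (f : mvop S T) : Prop :=
  exists F : baire -> baire -> Prop, computable_baire F /\
    forall p x, delta p x -> mvdom f x ->
      exists q, F p q /\ exists y, delta' q y /\ mvval f x y.

Definition bpair (p q : baire) : baire :=
  fun n => if odd n then q n./2 else p n./2.

Definition bomega (ps : nat -> baire) : baire := fun n => ps (nfst n) (nsnd n).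

Definition prod_naming (S T : Type) (delta : naming S) (delta' : naming T) :
    naming (S * T) :=
  fun r z => exists p q, [/\ r = bpair p q, delta p z.1 & delta' q z.2].

Definition pow_naming (T : Type) (delta : naming T) : naming (nat -> T) :=
  fun r x => exists ps, r = bomega ps /\ forall i, delta (ps i) (x i).

Definition nat_naming : naming nat := fun p n => p 0%N = n.

(** n = <<a, b>, c> denotes (a - b) / (c + 1). *)
Definition nu_rat (n : nat) : rat :=
  ((nfst (nfst n))%:R - (nsnd (nfst n))%:R) / (nsnd n).+1%:R.

Definition nu_qpos (n : nat) : rat := (nfst n).+1%:R / (nsnd n).+1%:R.

Definition computable_double_seq (R : realType) (x : nat -> nat -> R) : Prop :=
  exists2 f : nat -> nat, computable_nat f &
    forall i j k, `|x i j - ratr (nu_rat (f (npair (npair i j) k)))| <= 2 ^- k.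

Definition computable_metric_space (R : realType) (X : metricType R)
    (nu : nat -> X) : Prop :=
  dense (range nu) /\ computable_double_seq (fun i j => mdist (nu i) (nu j)).

Section Hyperspaces.
Context (R : realType) (X : metricType R) (nu : nat -> X).

Definition cauchy_naming : naming X := fun p x =>
  (fun i => nu (p i)) @ \oo --> x /\
  forall i j, mdist (nu (p i)) (nu (p j)) < 2 ^- minn i j.

Definition alpha (n : nat) : set X :=
  ball (nu (nfst n)) (ratr (nu_qpos (nsnd n))).

Definition sigma01 : naming (set X) := fun p U =>
  U = \bigcup_(i in [set i | (1 <= p i)%N]) alpha (p i).-1.

Definition pi01 : naming (set X) := fun p A =>
  exists2 U, sigma01 p U & A = ~` U.

End Hyperspaces.

(** A nonempty subset is zero-dimensional if its relative topology, carried by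
    the subtype [set_type Y], has a basis of clopen sets. Separability and
    metrizability are inherited from the ambient space. The library predicate
    [zero_dimensional] is a different notion (clopen sets separate points). *)
Definition zero_dimensional_set (T : topologicalType) (Y : set T) : Prop :=
  Y !=set0 /\
  exists2 C : set (set (set_type Y)), basis C & C `<=` clopen.

Definition refined_inclusion (T : Type) (al U : nat -> set T)
    (r : nat -> nat -> Prop) : Prop :=
  (forall a b, r a b -> U a `<=` al b) /\
  (forall b x, al b x -> exists a, U a x /\ r a b).

Section Operations.
Context (R : realType) (X : metricType R) (nu : nat -> X).
Context (deltaY : naming (set X)).

Local Notation Sigma := (sigma01 nu).
Local Notation Pi := (pi01 nu).

Definition opN : mvop (set X * set X * set X) (set X * set X) :=
  {| mvdom := [set z | let: (A, B, Y) := z in A `&` B = set0];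
     mvval := fun z => [set w | let: (A, B, Y) := z in let: (U, V) := w in
       [/\ A `<=` U, B `<=` V, U `&` V = set0 & Y `<=` U `|` V]] |}.

Definition N_computable : Prop :=
  mv_computable (prod_naming (prod_naming Pi Pi) deltaY)
    (prod_naming Sigma Sigma) opN.

Definition opM : mvop (X * set X * set X) (set X * set X) :=
  {| mvdom := [set z | let: (x, U, Y) := z in U x];
     mvval := fun z => [set w | let: (x, U, Y) := z in let: (V, W) := w in
       [/\ V x, V `<=` U, V `&` W = set0 & Y `<=` V `|` W]] |}.

Definition M_computable : Prop :=
  mv_computable (prod_naming (prod_naming (cauchy_naming nu) Sigma) deltaY)
    (prod_naming Sigma Sigma) opM.

Definition opB :
    mvop (set X) ((nat -> set X * set X) * (nat -> nat * nat)) :=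
  {| mvdom := setT;
     mvval := fun Y => [set w | let: (UV, ab) := w in
       let U := fun i => (UV i).1 in let V := fun i => (UV i).2 in
       [/\ basis (range U),
           forall i, U i `&` V i = set0 /\ Y `<=` U i `|` V i
         & refined_inclusion (alpha nu) U
             (fun a b => exists k, ab k = (a, b))]] |}.

Definition B_computable : Prop :=
  mv_computable deltaY
    (prod_naming (pow_naming (prod_naming Sigma Sigma))
       (pow_naming (prod_naming nat_naming nat_naming))) opB.

Definition opS : mvop ((nat -> set X) * set X) (nat -> set X) :=
  {| mvdom := [set z | let: (V, Y) := z in Y `<=` \bigcup_i V i];
     mvval := fun z => [set W | let: (V, Y) := z in
       [/\ forall i, W i `<=` V i, Y `<=` \bigcup_i W i & trivIset setT W]] |}.

Definition S_computable : Prop :=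
  mv_computable (prod_naming (pow_naming Sigma) deltaY)
    (pow_naming Sigma) opS.

End Operations.

(* Main.v *)
(* N -> M: apply N to the closed sets {x} and the complement of U.
   M -> B: a finite computation reads only a prefix of a Cauchy name, so M need
   only be run on the ideal ball b and the eventually constant names of ideal
   points of b: whatever M does on an arbitrary name of a point x of b is already
   done, up to a ball containing x, on the eventually constant name of a nearby
   ideal point. The resulting sets V, with b recorded, form the basis.
   B -> S: list the pieces (U_t, V_t) of the basis such that the refined inclusion
   places U_t inside a ball enumerated into some V_j; the sets
   D_t = U_t & V_0 & ... & V_(t-1) are pairwise disjoint and cover Y, and W_j is
   the union of the D_t placed in V_j. *)
Require Import Defs.
From mathcomp Require Import all_boot all_order all_algebra.
From mathcomp Require Import all_classical all_reals all_analysis.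
From mathcomp Require Import zify ring lra.
From Stdlib Require Cantor.

Set Implicit Arguments.
Unset Strict Implicit.
Unset Printing Implicit Defensive.

Import Order.TTheory GRing.Theory Num.Theory.

Local Open Scope classical_set_scope.

(** * Pairing, and closure properties of functions computable in an oracle *)

Lemma nfst_npair a b : nfst (npair a b) = a.
Proof. by rewrite /nfst /npair Cantor.cancel_of_to. Qed.

Lemma nsnd_npair a b : nsnd (npair a b) = b.
Proof. by rewrite /nsnd /npair Cantor.cancel_of_to. Qed.

Lemma npair_eta n : npair (nfst n) (nsnd n) = n.
Proof. by rewrite /nfst /nsnd /npair -surjective_pairing Cantor.cancel_to_of. Qed.

Opaque nfst nsnd npair.

Definition npairE := (nfst_npair, nsnd_npair).

(** One program serves all indices. An index may carry more than its oracle, such as the object that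
    the oracle names, so [f i] can be defined by choice and still be uniformly computable. *)
Definition computable_in (I : Type) (o : I -> baire) (f : I -> nat -> nat) :=
  exists c, forall i n, peval (o i) c n (f i n).

Section ComputableIn.
Context (I : Type) (o : I -> baire).
Local Notation cin := (computable_in o).
Implicit Types (f g h : I -> nat -> nat) (b e : I -> nat -> bool).

Lemma cin_ext f g : (forall i n, f i n = g i n) -> cin f -> cin g.
Proof. by move=> fg [c cP]; exists c => i n; rewrite -fg. Qed.

Lemma cin_id : cin (fun _ n => n).
Proof.
exists (CPair CFst CSnd) => i n /=.
by exists (nfst n), (nsnd n); rewrite npair_eta.
Qed.

Lemma cin_comp f g : cin f -> cin g -> cin (fun i n => f i (g i n)).
Proof. by move=> [c cP] [d dP]; exists (CComp c d) => i n /=; exists (g i n). Qed.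

Lemma cin_const k : cin (fun _ _ => k).
Proof.
elim: k => [|k [c cP]]; first by exists CZero.
by exists (CComp CSucc c) => i n /=; exists k.
Qed.

Lemma cin_succ f : cin f -> cin (fun i n => (f i n).+1).
Proof. by move=> cf; apply: (@cin_comp (fun _ n => n.+1)) => //; exists CSucc. Qed.

Lemma cin_nfst f : cin f -> cin (fun i n => nfst (f i n)).
Proof. by move=> cf; apply: (@cin_comp (fun _ n => nfst n)) => //; exists CFst. Qed.

Lemma cin_nsnd f : cin f -> cin (fun i n => nsnd (f i n)).
Proof. by move=> cf; apply: (@cin_comp (fun _ n => nsnd n)) => //; exists CSnd. Qed.

Lemma cin_oracle f : cin f -> cin (fun i n => o i (f i n)).
Proof. by move=> cf; apply: (@cin_comp (fun i n => o i n)) => //; exists COracle. Qed.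

Lemma cin_npair f g : cin f -> cin g -> cin (fun i n => npair (f i n) (g i n)).
Proof.
by move=> [c cP] [d dP]; exists (CPair c d) => i n /=; exists (f i n), (g i n).
Qed.

Lemma cin_rec f (g : I -> nat -> nat -> nat -> nat) h :
    cin f -> cin (fun i n => g i (nfst n) (nfst (nsnd n)) (nsnd (nsnd n))) ->
    cin h ->
  cin (fun i n => nat_rect (fun=> nat) (f i n) (g i n) (h i n)).
Proof.
move=> [c cP] [d dP] ch.
have [e eP] := cin_npair cin_id ch.
exists (CComp (CPrec c d) e) => i n /=; exists (npair n (h i n)); split=> //.
rewrite !npairE; exists (nat_rect (fun=> nat) (f i n) (g i n)); split=> // j _.
by have := dP i (npair n (npair j (nat_rect (fun=> nat) (f i n) (g i n) j)));
  rewrite !npairE.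
Qed.

(** The conditional is a primitive recursion whose number of steps is the truth value, so the
    program for [f] runs only where [b] holds and may diverge elsewhere. *)
Lemma cin_lazy_if b f g :
    cin (fun i n => b i n) -> cin g ->
    (exists c, forall i n, b i n -> peval (o i) c n (f i n)) ->
  cin (fun i n => if b i n then f i n else g i n).
Proof.
move=> cb [d dP] [c cP]; have [e eP] := cin_npair cin_id cb.
exists (CComp (CPrec d (CComp c CFst)) e) => i n /=.
exists (npair n (b i n)); split=> //; rewrite !npairE.
exists (fun j => if j is _.+1 then f i n else g i n); split=> //.
  move=> j; case: (boolP (b i n)) => //= bT _; exists n.
  by rewrite nfst_npair; split=> //; apply: cP.
by case: (b i n).
Qed.

Lemma cin_if b f g : cin (fun i n => b i n) -> cin f -> cin g ->
  cin (fun i n => if b i n then f i n else g i n).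
Proof. by move=> cb [c cP] cg; apply: cin_lazy_if => //; exists c. Qed.

Lemma cin_add f g : cin f -> cin g -> cin (fun i n => f i n + g i n).
Proof.
move=> cf cg; apply: (@cin_ext (fun i n =>
  nat_rect (fun=> nat) (f i n) (fun _ v => v.+1) (g i n))).
  by move=> i n; elim: (g i n) => [|k /= ->]; rewrite ?addn0 ?addnS.
by apply: (cin_rec cf) cg; do !apply: cin_succ; do !apply: cin_nsnd; exact: cin_id.
Qed.

Lemma cin_mul f g : cin f -> cin g -> cin (fun i n => f i n * g i n).
Proof.
move=> cf cg; apply: (@cin_ext (fun i n =>
  nat_rect (fun=> nat) 0 (fun _ v => v + f i n) (g i n))).
  by move=> i n; elim: (g i n) => [|k /= ->]; rewrite ?muln0 // mulnS addnC.
apply: (cin_rec (cin_const 0) _ cg); apply: cin_add.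
  by do !apply: cin_nsnd; exact: cin_id.
by apply: (cin_comp cf); apply: cin_nfst; exact: cin_id.
Qed.

Lemma cin_pred f : cin f -> cin (fun i n => (f i n).-1).
Proof.
move=> cf; apply: (@cin_ext (fun i n =>
  nat_rect (fun=> nat) 0 (fun k _ => k) (f i n))).
  by move=> i n; case: (f i n).
by apply: (cin_rec (cin_const 0) _ cf); apply: cin_nfst; apply: cin_nsnd; exact: cin_id.
Qed.

Lemma cin_sub f g : cin f -> cin g -> cin (fun i n => f i n - g i n).
Proof.
move=> cf cg; apply: (@cin_ext (fun i n =>
  nat_rect (fun=> nat) (f i n) (fun _ v => v.-1) (g i n))).
  by move=> i n; elim: (g i n) => [|k /= ->]; rewrite ?subn0 ?subnS.
by apply: (cin_rec cf) cg; apply: cin_pred; do !apply: cin_nsnd; exact: cin_id.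
Qed.

Lemma cin_leq f g : cin f -> cin g -> cin (fun i n => f i n <= g i n).
Proof.
move=> cf cg; apply: (@cin_ext (fun i n => 1 - (f i n - g i n))).
  by move=> i n; rewrite /leq; case: (f i n - g i n).
by apply: cin_sub; [exact: cin_const|exact: cin_sub].
Qed.

Lemma cin_and b e : cin (fun i n => b i n) -> cin (fun i n => e i n) ->
  cin (fun i n => b i n && e i n).
Proof.
move=> cb ce; apply: (@cin_ext (fun i n => b i n * e i n)); last exact: cin_mul.
by move=> i n; case: (b i n); case: (e i n).
Qed.

Lemma cin_eq f g : cin f -> cin g -> cin (fun i n => f i n == g i n).
Proof.
move=> cf cg.
apply: (@cin_ext (fun i n => (f i n <= g i n) && (g i n <= f i n))).
  by move=> i n; rewrite eqn_leq.
by apply: cin_and; apply: cin_leq.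
Qed.

Lemma cin_odd f : cin f -> cin (fun i n => odd (f i n)).
Proof.
move=> cf; apply: (@cin_ext (fun i n =>
  nat_rect (fun=> nat) 0 (fun _ v => 1 - v) (f i n))).
  by move=> i n; elim: (f i n) => //= k ->; case: (odd k).
apply: (cin_rec (cin_const 0) _ cf); apply: cin_sub; first exact: cin_const.
by do !apply: cin_nsnd; exact: cin_id.
Qed.

Lemma cin_half f : cin f -> cin (fun i n => (f i n)./2).
Proof.
move=> cf; apply: (@cin_ext (fun i n =>
  nat_rect (fun=> nat) 0 (fun k v => odd k + v) (f i n))).
  by move=> i n; elim: (f i n) => //= k ->; rewrite uphalf_half.
apply: (cin_rec (cin_const 0) _ cf); apply: cin_add.
  by apply: cin_odd; apply: cin_nfst; apply: cin_nsnd; exact: cin_id.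
by do !apply: cin_nsnd; exact: cin_id.
Qed.

Lemma cin_double f : cin f -> cin (fun i n => (f i n).*2).
Proof.
move=> cf; apply: (@cin_ext (fun i n => f i n + f i n)); last exact: cin_add.
by move=> i n; rewrite addnn.
Qed.

Lemma cin_exp k f : cin f -> cin (fun i n => k ^ f i n).
Proof.
move=> cf; apply: (@cin_ext (fun i n =>
  nat_rect (fun=> nat) 1 (fun _ v => k * v) (f i n))).
  by move=> i n; elim: (f i n) => //= j ->; rewrite expnS.
apply: (cin_rec (cin_const 1) _ cf); apply: cin_mul; first exact: cin_const.
by do !apply: cin_nsnd; exact: cin_id.
Qed.

Lemma cin_minn f g : cin f -> cin g -> cin (fun i n => minn (f i n) (g i n)).
Proof.
move=> cf cg; apply: (@cin_ext (fun i n => f i n - (f i n - g i n))).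
  by move=> i n; rewrite minnE.
by do !apply: cin_sub.
Qed.

Lemma cin_all (b : I -> nat -> nat -> bool) f :
    cin (fun i n => b i (nfst n) (nsnd n)) -> cin f ->
  cin (fun i n => all (b i n) (iota 0 (f i n))).
Proof.
move=> cb cf; apply: (@cin_ext (fun i n =>
  nat_rect (fun=> nat) 1 (fun k v => v * b i n k) (f i n))).
  move=> i n; elim: (f i n) => // k IH; rewrite -[in RHS]addn1 iotaD all_cat [LHS]/= IH.
  by rewrite /= andbT; case: (all _ _); case: (b _ _ _).
apply: (cin_rec (cin_const 1) _ cf); apply: cin_mul.
  by do !apply: cin_nsnd; exact: cin_id.
apply: (@cin_ext (fun i n => b i (nfst (npair (nfst n) (nfst (nsnd n))))
  (nsnd (npair (nfst n) (nfst (nsnd n)))))).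
  by move=> i n; rewrite !npairE.
apply: (cin_comp cb); apply: cin_npair; apply: cin_nfst; rewrite ?/id.
  exact: cin_id.
by apply: cin_nsnd; exact: cin_id.
Qed.

End ComputableIn.

Arguments cin_id {I o}.

(** * Oracle substitution and the use principle *)

(* Substitution of the program [g] for the oracle; since the substituted oracle
   may depend on a parameter [t], inputs [n] become [npair t n]. *)
Fixpoint relativize (g c : program) : program :=
  match c with
  | CZero => CZero
  | CSucc => CComp CSucc CSnd
  | CFst => CComp CFst CSnd
  | CSnd => CComp CSnd CSnd
  | COracle => g
  | CPair c d => CPair (relativize g c) (relativize g d)
  | CComp c d => CComp (relativize g c) (CPair CFst (relativize g d))
  | CPrec c d =>
      CComp (CPrec (relativize g c)
               (CComp (relativize g d)
                  (CPair (CComp CFst CFst) (CPair (CComp CSnd CFst) CSnd))))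
        (CPair (CPair CFst (CComp CFst CSnd)) (CComp CSnd CSnd))
  | CMu c =>
      CMu (CComp (relativize g c)
             (CPair (CComp CFst CFst) (CPair (CComp CSnd CFst) CSnd)))
  end.

Lemma peval_relativize (p q : baire) (g c : program) t n m :
    (forall k, peval p g (npair t k) (q k)) ->
  peval q c n m -> peval p (relativize g c) (npair t n) m.
Proof.
move=> gP.
(* [CPrec] and [CMu] pair new data to the right of the whole input; this program reassociates, so
   that the parameter [t] stands alone in front again. *)
have assoc a x : exists y,
    peval p (CPair (CComp CFst CFst) (CPair (CComp CSnd CFst) CSnd))
      (npair (npair t a) x) y /\ y = npair t (npair a x).
  exists (npair t (npair a x)); split=> //=; exists t, (npair a x); split=> //.
    by exists (npair t a); rewrite !npairE.
  exists a, x; rewrite !npairE; split=> //.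
  by exists (npair t a); rewrite !npairE.
elim: c n m => [||||||||].
- by [].
- by move=> n m /= ->; exists n; rewrite nsnd_npair.
- by move=> n m /= ->; exists n; rewrite nsnd_npair.
- by move=> n m /= ->; exists n; rewrite nsnd_npair.
- by move=> n m /= ->.
- move=> c IHc d IHd n m /= [a [b [ca db ->]]].
  by exists a, b; split=> //; [exact: IHc|exact: IHd].
- move=> c IHc d IHd n m /= [a [da cm]]; exists (npair t a); split; last exact: IHc.
  by exists t, a; rewrite nfst_npair; split=> //; exact: IHd.
- move=> c IHc d IHd n m [s [cs ds ->]].
  exists (npair (npair t (nfst n)) (nsnd n)); split.
    exists (npair t (nfst n)), (nsnd n); split=> //.
      exists t, (nfst n); split=> //; first by rewrite /= nfst_npair.
      by exists n; rewrite /= nsnd_npair.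
    by exists n; rewrite /= nsnd_npair.
  exists s; rewrite !npairE; split=> // [|j lj]; first exact: IHc.
  have [y [ya yE]] := assoc (nfst n) (npair j (s j)).
  by exists y; split=> //; rewrite yE; apply/IHd/ds.
- move=> c IHc n m [cm cv]; split.
    have [y [ya yE]] := assoc n m.
    by exists y; split=> //; rewrite yE; apply/IHc.
  move=> j /cv[v cjv]; exists v; have [y [ya yE]] := assoc n j.
  by exists y; split=> //; rewrite yE; apply/IHc.
Qed.

(** The maximum of finitely many thresholds serves all [i < n]. *)
Lemma bounded_choice (n : nat) (P : nat -> nat -> Prop) :
    (forall i, (i < n)%N -> exists K, forall k, (K <= k)%N -> P i k) ->
  exists K, forall k, (K <= k)%N -> forall i, (i < n)%N -> P i k.
Proof.
elim: n => [|n IH] H; first by exists 0%N.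
have [|K KP] := IH; first by move=> i /ltnW; exact: H.
have [L LP] := H n (ltnSn n); exists (maxn K L) => k; rewrite geq_max => /andP[Kk Lk] i.
by rewrite ltnS leq_eqVlt => /predU1P[->|/KP]; [exact: LP|apply].
Qed.

(* The use principle: a halting computation reads a finite part of the oracle. *)
Lemma peval_use p c n m : peval p c n m ->
  exists L, forall K, (L <= K)%N ->
    forall q : baire, (forall i, (i < K)%N -> q i = p i) -> peval q c n m.
Proof.
elim: c n m => [||||||||].
1-4: by exists 0%N.
- by move=> n m /= ->; exists n.+1 => K nK q ->.
- move=> c IHc d IHd n m /= [a [b [/IHc[L LP] /IHd[L' LP'] ->]]].
  exists (maxn L L') => K; rewrite geq_max => /andP[LK LK'] q qp.
  exists a, b; split=> //.
    exact: LP qp.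
  exact: LP' qp.
- move=> c IHc d IHd n m /= [a [/IHd[L LP] /IHc[L' LP']]].
  exists (maxn L L') => K; rewrite geq_max => /andP[LK LK'] q qp.
  exists a; split=> //.
    exact: LP qp.
  exact: LP' qp.
- move=> c IHc d IHd n m [s [/IHc[L LP] ds ->]].
  have [L' LP'] := bounded_choice (fun i li => IHd _ _ (ds i li)).
  exists (maxn L L') => K; rewrite geq_max => /andP[LK LK'] q qp.
  exists s; split=> //; first exact: LP qp.
  by move=> i li; exact: LP' qp.
- move=> c IHc n m [/IHc[L LP] cv].
  (* The search also depends on the tests before [m]; these are finitely many, so their bounds can
     be joined. *)
  have [|L' LP'] := @bounded_choice m (fun i K => forall q : baire,
    (forall i, (i < K)%N -> q i = p i) -> exists v, peval q c (npair n i) v.+1).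
    move=> i /cv[v /IHc[L' LP']]; exists L' => K LK q qp; exists v; exact: LP' qp.
  exists (maxn L L') => K; rewrite geq_max => /andP[LK LK'] q qp.
  by split; [exact: LP qp|move=> i li; exact: (LP' K LK' i li q qp)].
Qed.

Lemma computable_nat_in (I : Type) (o : I -> baire) f g :
  computable_nat f -> computable_in o g -> computable_in o (fun i n => f (g i n)).
Proof.
move=> [c cP] cg; apply: (@cin_comp _ _ (fun _ => f)) => //.
have [d dP] := cin_npair (@cin_const _ o 0) cin_id.
exists (CComp (relativize CZero c) d) => i n /=.
by exists (npair 0 n); split=> //; apply: peval_relativize (cP n).
Qed.

(** Used to invoke a realizer [c] on a name that is itself computed from [o i] and a parameter
    [t]. *)
Lemma cin_relativize (I : Type) (o : I -> baire) (q : I -> nat -> baire) c :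
    computable_in o (fun i n => q i (nfst n) (nsnd n)) ->
  exists d, forall i t n m, peval (q i t) c n m -> peval (o i) d (npair t n) m.
Proof.
move=> [g gP]; exists (relativize g c) => i t n m.
apply: peval_relativize => k.
by have := gP i (npair t k); rewrite !npairE.
Qed.

(** * Arithmetic on codes of rationals *)

Definition qadd (x y : nat) : nat :=
  npair (npair (nfst (nfst x) * (nsnd y).+1 + nfst (nfst y) * (nsnd x).+1)
               (nsnd (nfst x) * (nsnd y).+1 + nsnd (nfst y) * (nsnd x).+1))
    ((nsnd x).+1 * (nsnd y).+1).-1.

Definition qopp (x : nat) : nat :=
  npair (npair (nsnd (nfst x)) (nfst (nfst x))) (nsnd x).

(** Cross multiplication, with the subtracted parts moved to the other side so that only natural
    numbers occur. *)
Definition qlt (x y : nat) : bool :=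
  nfst (nfst x) * (nsnd y).+1 + nsnd (nfst y) * (nsnd x).+1 <
  nfst (nfst y) * (nsnd x).+1 + nsnd (nfst x) * (nsnd y).+1.

(** Turns a code for [nu_qpos] into a code for [nu_rat]. *)
Definition qpos (n : nat) : nat := npair (npair (nfst n).+1 0) (nsnd n).

Definition half_pow (k : nat) : nat := npair 0 (2 ^ k).-1.

Section RationalCodes.
Local Open Scope ring_scope.
Variable R : realType.

Definition qval (x : nat) : R := ratr (nu_rat x).
Definition qradius (n : nat) : R := ratr (nu_qpos n).

Lemma qvalD x y : qval (qadd x y) = qval x + qval y.
Proof.
rewrite /qval -rmorphD /=; congr ratr; rewrite /nu_rat /qadd !npairE.
rewrite prednK ?muln_gt0 // !natrD !natrM.
have hx : (nsnd x).+1%:R != 0 :> rat by rewrite pnatr_eq0.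
have hy : (nsnd y).+1%:R != 0 :> rat by rewrite pnatr_eq0.
by field; apply/andP.
Qed.

Lemma qvalN x : qval (qopp x) = - qval x.
Proof.
rewrite /qval -rmorphN /=; congr ratr; rewrite /nu_rat /qopp !npairE.
by rewrite -mulNr opprB.
Qed.

Lemma qltE x y : qlt x y = (qval x < qval y).
Proof.
rewrite /qval ltr_rat /nu_rat ltr_pdivrMr ?ltr0n // mulrAC ltr_pdivlMr ?ltr0n //.
by rewrite /qlt !mulrBl ltrBlDr addrAC ltrBrDr -!natrM -!natrD ltr_nat.
Qed.

Lemma qval_pos n : qval (qpos n) = qradius n.
Proof. by rewrite /qval /qradius /nu_rat /nu_qpos /qpos !npairE subr0. Qed.

Lemma qradius_half_pow k : qradius (half_pow k) = 2 ^- k.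
Proof.
rewrite /qradius /nu_qpos /half_pow !npairE prednK ?expn_gt0 // mul1r.
by rewrite fmorphV natrX rmorphXn /= ratr_nat.
Qed.

Lemma half_pow_small (e : R) : 0 < e ->
  exists K, forall k, (K <= k)%N -> 2 ^- k < e.
Proof.
move=> e0; have [K _ KP] := near_infty_natSinv_expn_lt (PosNum e0).
by exists K => k /KP; rewrite div1r.
Qed.

End RationalCodes.

(** * Ideal balls and enumerated open sets *)

Section IdealBalls.
Local Open Scope ring_scope.
Context (R : realType) (X : metricType R) (nu : nat -> X).
Local Notation rad := (qradius R).
Local Notation alpha := (alpha nu).

Lemma alphaE c x : alpha c x = (mdist (nu (nfst c)) x < rad (nsnd c)) :> Prop.
Proof. by rewrite /Defs.alpha ballEmdist. Qed.

(** Every [p] names an open set, so [sigma01] is the graph of this function. *)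
Definition sigma_set (p : baire) : set X :=
  \bigcup_(i in [set i | (1 <= p i)%N]) alpha (p i).-1.

Lemma sigma_setP p x : sigma_set p x <-> exists i c, p i = c.+1 /\ alpha c x.
Proof.
split=> [[i /= pi] ax|[i [c [pic ax]]]]; last by exists i; rewrite /= pic.
by exists i, (p i).-1; rewrite prednK.
Qed.

Lemma open_alpha c : open (alpha c).
Proof.
rewrite openE => x; rewrite alphaE => xc; rewrite /interior -nbhs_ballE.
exists (rad (nsnd c) - mdist (nu (nfst c)) x); first by rewrite /= subr_gt0.
move=> y; rewrite ballEmdist alphaE /= ltrBrDl; apply: le_lt_trans.
exact: metric_triangle.
Qed.

Lemma open_sigma_set p : open (sigma_set p).
Proof. by apply: bigcup_open => i _; exact: open_alpha. Qed.

Hypothesis nu_dense : dense (range nu).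

Lemma dense_point x (e : R) : 0 < e -> exists a, mdist (nu a) x < e.
Proof.
move=> e0; have [||y [+ [a _ ay]]] := nu_dense (O := (ball x e)^°).
- by exists x; apply: nbhsx_ballx.
- exact: open_interior.
move=> /interior_subset; rewrite ballEmdist /= => xy.
by exists a; rewrite ay metric_sym.
Qed.

Lemma small_alpha x (e : R) : 0 < e -> exists c, alpha c x /\ rad (nsnd c) < e.
Proof.
move=> e0; have [K /(_ K (leqnn K)) Ke] := half_pow_small e0.
have [|a ax] := @dense_point x (2 ^- K); first by rewrite invr_gt0 exprn_gt0.
by exists (npair a (half_pow K)); rewrite alphaE !npairE qradius_half_pow.
Qed.

Lemma alpha_nbhs x (O : set X) : nbhs x O -> exists c, alpha c x /\ alpha c `<=` O.
Proof.
rewrite -nbhs_ballE => -[e /= e0 eO].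
have [|c [cx ce]] := @small_alpha x (e / 2); first by rewrite divr_gt0.
exists c; split=> // y; rewrite alphaE in cx; rewrite alphaE => cy; apply: eO.
rewrite ballEmdist /= (le_lt_trans (metric_triangle _ (nu (nfst c)) _)) //.
by rewrite metric_sym [e]splitr ltrD // (lt_trans _ ce).
Qed.

End IdealBalls.

(** * Semi-decidable comparison of distances *)

Section DistanceTests.
Local Open Scope ring_scope.
Context (R : realType) (X : metricType R) (nu : nat -> X) (D : nat -> nat).
Hypothesis DP : forall i j k,
  `|mdist (nu i) (nu j) - qval R (D (npair (npair i j) k))| <= 2 ^- k.
Local Notation dist a b := (mdist (nu a) (nu b)).

(* Decidable conditions which semi-decide [dist a b < qval r] and
   [qval r < dist a b] as the precision [k] grows. *)
Definition closer (a b r k : nat) : bool :=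
  qlt (qadd (D (npair (npair a b) k)) (qpos (half_pow k))) r.
Definition farther (a b r k : nat) : bool :=
  qlt (qadd r (qpos (half_pow k))) (D (npair (npair a b) k)).

Lemma closer_sound a b r k : closer a b r k -> dist a b < qval R r.
Proof.
rewrite /closer (qltE R) qvalD qval_pos qradius_half_pow.
by have := DP a b k; rewrite ler_norml => /andP[_ h1] h2; lra.
Qed.

Lemma farther_sound a b r k : farther a b r k -> qval R r < dist a b.
Proof.
rewrite /farther (qltE R) qvalD qval_pos qradius_half_pow.
by have := DP a b k; rewrite ler_norml => /andP[h1 _] h2; lra.
Qed.

Lemma closer_complete a b r : dist a b < qval R r ->
  exists K, forall k, (K <= k)%N -> closer a b r k.
Proof.
(* The approximation error and the margin in the test each cost at most 2^-k, hence half of the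
   gap. *)
move=> lt; have [|K KP] := @half_pow_small R ((qval R r - dist a b) / 2).
  by rewrite divr_gt0 // subr_gt0.
exists K => k /KP h; rewrite /closer (qltE R) qvalD qval_pos qradius_half_pow.
by have := DP a b k; rewrite ler_norml => /andP[h1 _]; lra.
Qed.

Lemma farther_complete a b r : qval R r < dist a b ->
  exists K, forall k, (K <= k)%N -> farther a b r k.
Proof.
move=> lt; have [|K KP] := @half_pow_small R ((dist a b - qval R r) / 2).
  by rewrite divr_gt0 // subr_gt0.
exists K => k /KP h; rewrite /farther (qltE R) qvalD qval_pos qradius_half_pow.
by have := DP a b k; rewrite ler_norml => /andP[_ h1]; lra.
Qed.

(* Formal inclusion of ideal balls, stronger than inclusion of the sets. *)
Definition inside (c e k : nat) : bool :=
  closer (nfst c) (nfst e) (qadd (qpos (nsnd e)) (qopp (qpos (nsnd c)))) k.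

Lemma inside_sound c e k : inside c e k -> alpha nu c `<=` alpha nu e.
Proof.
move=> /closer_sound; rewrite qvalD qvalN !qval_pos => h y.
rewrite !alphaE metric_sym in h *; move=> cy.
by have := metric_triangle (nu (nfst e)) (nu (nfst c)) y; lra.
Qed.

(** Half of the slack at [x] suffices, since the centres are closer than the radius of [c] plus the
    distance from [x] to the centre of [e]. The bound is independent of [c], so finitely many
    inclusions can be met at once. *)
Lemma inside_complete x e : alpha nu e x -> exists2 d : R, 0 < d &
  forall c, alpha nu c x -> qradius R (nsnd c) < d ->
    exists K, forall k, (K <= k)%N -> inside c e k.
Proof.
rewrite alphaE => ex.
exists ((qradius R (nsnd e) - mdist (nu (nfst e)) x) / 2).
  by rewrite divr_gt0 // subr_gt0.
move=> c; rewrite alphaE => cx cd; apply: closer_complete.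
rewrite qvalD qvalN !qval_pos.
have := metric_triangle (nu (nfst c)) x (nu (nfst e)).
by rewrite [mdist x _]metric_sym; lra.
Qed.

End DistanceTests.

(** * Computability of the tests *)

(* Dispatching on the syntax of the goal: unification alone would unfold the
   pairing functions. *)
Ltac cin_basic_step :=
  lazymatch goal with
  | |- computable_in _ (fun i n => n) => exact: cin_id
  | |- computable_in _ (fun _ _ => ?k) => exact: cin_const
  | |- computable_in _ (fun i n => S (@?f i n)) => apply: cin_succ
  | |- computable_in _ (fun i n => Nat.pred (@?f i n)) => apply: cin_pred
  | |- computable_in _ (fun i n => nfst (@?f i n)) => apply: cin_nfst
  | |- computable_in _ (fun i n => nsnd (@?f i n)) => apply: cin_nsnd
  | |- computable_in _ (fun i n => npair (@?f i n) (@?g i n)) =>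
      apply: cin_npair
  | |- computable_in _ (fun i n => addn (@?f i n) (@?g i n)) => apply: cin_add
  | |- computable_in _ (fun i n => muln (@?f i n) (@?g i n)) => apply: cin_mul
  | |- computable_in _ (fun i n => subn (@?f i n) (@?g i n)) => apply: cin_sub
  | |- computable_in _ (fun i n => nat_of_bool (leq (@?f i n) (@?g i n))) =>
      apply: cin_leq
  | |- computable_in _ (fun i n => nat_of_bool (andb (@?f i n) (@?g i n))) =>
      apply: cin_and
  | |- computable_in _ (fun i n => nat_of_bool (eq_op (@?f i n) (@?g i n))) =>
      apply: cin_eq
  | |- computable_in _ (fun i n => nat_of_bool (odd (@?f i n))) =>
      apply: cin_odd
  | |- computable_in _ (fun i n => half (@?f i n)) => apply: cin_half
  | |- computable_in _ (fun i n => double (@?f i n)) => apply: cin_double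
  | |- computable_in _ (fun i n => expn ?k (@?f i n)) => apply: cin_exp
  | |- computable_in _ (fun i n => minn (@?f i n) (@?g i n)) => apply: cin_minn
  | |- computable_in ?o (fun i n => ?o i (@?f i n)) => apply: cin_oracle
  | |- computable_in _ (fun i n => i (@?f i n)) => apply: (@cin_oracle _ id)
  end.

(** A hook for later definitions, tried before the basic steps so that [nfst (iter _ nsnd _)] is not
    split at [nfst]. *)
Ltac cin_further_step := fail.

Ltac cin_auto :=
  repeat first [assumption | cin_further_step | cin_basic_step | apply: cin_if].

Section ComputableTests.
Context (I : Type) (o : I -> baire).
Local Notation cin := (computable_in o).
Context (a b : I -> nat -> nat) (ca : cin a) (cb : cin b).

Lemma cin_half_pow : cin (fun i n => half_pow (a i n)).
Proof. by rewrite /half_pow; cin_auto. Qed.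

Lemma cin_qpos : cin (fun i n => qpos (a i n)).
Proof. by rewrite /qpos; cin_auto. Qed.

Lemma cin_qadd : cin (fun i n => qadd (a i n) (b i n)).
Proof. by rewrite /qadd; cin_auto. Qed.

Lemma cin_qopp : cin (fun i n => qopp (a i n)).
Proof. by rewrite /qopp; cin_auto. Qed.

Lemma cin_qlt : cin (fun i n => qlt (a i n) (b i n)).
Proof. by rewrite /qlt; cin_auto. Qed.

(** Finite words are coded by iterated pairing; entry [j] is reached by [j] times [nsnd] and then
    [nfst]. *)
Lemma cin_word : cin (fun i n => nfst (iter (a i n) nsnd (b i n))).
Proof.
apply: cin_nfst; apply: (@cin_ext _ _ (fun i n =>
  nat_rect (fun=> nat) (b i n) (fun _ v => nsnd v) (a i n))).
  by move=> i n; elim: (a i n) => //= j ->.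
by apply: (cin_rec cb _ ca); cin_auto.
Qed.

End ComputableTests.

Ltac cin_code_step :=
  lazymatch goal with
  | |- computable_in _ (fun i n => nfst (iter (@?f i n) nsnd (@?g i n))) =>
      apply: cin_word
  | |- computable_in _ (fun i n => half_pow (@?f i n)) => apply: cin_half_pow
  | |- computable_in _ (fun i n => qpos (@?f i n)) => apply: cin_qpos
  | |- computable_in _ (fun i n => qadd (@?f i n) (@?g i n)) => apply: cin_qadd
  | |- computable_in _ (fun i n => qopp (@?f i n)) => apply: cin_qopp
  | |- computable_in _ (fun i n => nat_of_bool (qlt (@?f i n) (@?g i n))) =>
      apply: cin_qlt
  end.

Ltac cin_further_step ::= cin_code_step.

Section ComputableDistanceTests.
Context (I : Type) (o : I -> baire) (D : nat -> nat) (cD : computable_nat D).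
Local Notation cin := (computable_in o).
Context (a b r k : I -> nat -> nat).
Context (ca : cin a) (cb : cin b) (cr : cin r) (ck : cin k).

Lemma cin_closer : cin (fun i n => closer D (a i n) (b i n) (r i n) (k i n)).
Proof.
apply: cin_qlt cr; apply: cin_qadd; last by apply: cin_qpos; exact: cin_half_pow.
by apply: computable_nat_in cD _; cin_auto.
Qed.

Lemma cin_farther : cin (fun i n => farther D (a i n) (b i n) (r i n) (k i n)).
Proof.
apply: cin_qlt; first by apply: cin_qadd => //; apply: cin_qpos; exact: cin_half_pow.
by apply: computable_nat_in cD _; cin_auto.
Qed.

End ComputableDistanceTests.

Lemma cin_inside (I : Type) (o : I -> baire) (D : nat -> nat) c e k :
    computable_nat D -> computable_in o c -> computable_in o e -> computable_in o k ->
  computable_in o (fun i n => inside D (c i n) (e i n) (k i n)).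
Proof. by move=> cD cc ce ck; rewrite /inside; apply: (cin_closer cD); cin_auto. Qed.

Ltac cin_further_step ::=
  first [cin_code_step | lazymatch goal with
  | |- computable_in _ (fun i n => nat_of_bool (closer _ (@?f i n) (@?g i n) (@?h i n) (@?k i n))) =>
      apply: cin_closer
  | |- computable_in _ (fun i n => nat_of_bool (farther _ (@?f i n) (@?g i n) (@?h i n) (@?k i n))) =>
      apply: cin_farther
  | |- computable_in _ (fun i n => nat_of_bool (inside _ (@?f i n) (@?g i n) (@?h i n))) =>
      apply: cin_inside
  end].

(** * Paired names and realizers *)

Definition evens (p : baire) : baire := fun n => p n.*2.
Definition odds (p : baire) : baire := fun n => p n.*2.+1.

Lemma evens_bpair p q : evens (bpair p q) = p.
Proof. by apply/funext => n; rewrite /evens /bpair odd_double doubleK. Qed.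

Lemma odds_bpair p q : odds (bpair p q) = q.
Proof.
by apply/funext => n; rewrite /odds /bpair /= odd_double uphalf_double.
Qed.

Lemma mv_computableE (S T : Type) (delta : naming S) (delta' : naming T)
    (f : mvop S T) : mv_computable delta delta' f <->
  exists c, forall p x, delta p x -> mvdom f x -> exists q,
    (forall n, peval p c n (q n)) /\ exists y, delta' q y /\ mvval f x y.
Proof.
split=> [[F [[c cP] FP]]|[c cP]].
  by exists c => p x /FP H /H[q [/cP]]; exists q.
by exists (fun p q => forall n, peval p c n (q n)); split=> //; exists c.
Qed.

(* Uniform form: a realizer computes a name of a value from a name of the
   argument, the argument itself being available to define that name. *)
Lemma mv_computable_in (S T : Type) (delta : naming S) (delta' : naming T)
    (f : mvop S T)
    (g : {z : baire * S | delta z.1 z.2 /\ mvdom f z.2} -> baire) :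
    computable_in (fun i => (sval i).1) g ->
    (forall i, exists y, delta' (g i) y /\ mvval f (sval i).2 y) ->
  mv_computable delta delta' f.
Proof.
move=> [c cP] gP; apply/mv_computableE; exists c => p x px fx.
pose i : {z : baire * S | delta z.1 z.2 /\ mvdom f z.2} :=
  exist _ (p, x) (conj px fx).
by exists (g i); split; [exact: (cP i)|exact: (gP i)].
Qed.

(** * From N to M: names of singletons *)

Section CauchyNames.
Local Open Scope ring_scope.
Context (R : realType) (X : metricType R) (nu : nat -> X) (D : nat -> nat).
Hypothesis DP : forall i j k,
  `|mdist (nu i) (nu j) - qval R (D (npair (npair i j) k))| <= 2 ^- k.
Hypothesis cD : computable_nat D.
Hypothesis nu_dense : dense (range nu).

(** Let the second index of the Cauchy bound tend to infinity; strictness is lost in the limit. *)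
Lemma cauchy_dist p x i : cauchy_naming nu p x -> mdist (nu (p i)) x <= 2 ^- i.
Proof.
move=> [px pC]; apply/ler_addgt0Pr => e e0.
have [K _ KP] := metricType_numDomainType.cvgr_dist_lt px e0.
have /= h := KP (maxn K i) (leq_maxl _ _).
apply: le_trans (metric_triangle _ (nu (p (maxn K i))) _) _.
rewrite metric_sym in h; apply/ltW/ltrD => //.
by have := pC i (maxn K i); rewrite (minn_idPl (leq_maxr _ _)).
Qed.

(** With [n] coding ((c, i), k), ball [c] is listed once precision [k] confirms that its centre is
    farther from [nu (p i)] than its radius plus 2^-i; it then misses every point within 2^-i of
    [nu (p i)]. *)
Definition singleton_name (p : baire) : baire := fun n =>
  let c := nfst (nfst n) in let i := nsnd (nfst n) in
  if farther D (nfst c) (p i) (qadd (qpos (nsnd c)) (qpos (half_pow i))) (nsnd n)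
  then c.+1 else 0%N.

Lemma singleton_nameP p x : cauchy_naming nu p x ->
  sigma_set nu (singleton_name p) = ~` [set x].
Proof.
move=> px; apply/seteqP; split=> y.
  move=> /sigma_setP[n [c []]]; rewrite /singleton_name.
  case: ifP => // /(farther_sound DP); rewrite qvalD !qval_pos qradius_half_pow.
  move=> h [<-]; rewrite alphaE => cy yx; rewrite {y}yx in cy.
  have := cauchy_dist (nsnd (nfst n)) px.
  by have := metric_triangle (nu (nfst (nfst (nfst n)))) x (nu (p (nsnd (nfst n))));
    rewrite [mdist x (nu (p _))]metric_sym; lra.
move=> /= yx; have d0 : 0 < mdist y x by rewrite mdist_gt0; apply/eqP.
(* With the radius and 2^-i both below a quarter of the distance, the centre of the ball is more
   than half of it away from [nu (p i)]. *)
have [|i /(_ i (leqnn i)) iP] := @half_pow_small R (mdist y x / 4).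
  by rewrite divr_gt0.
have [|c [cy cr]] := @small_alpha _ _ _ nu_dense y (mdist y x / 4).
  by rewrite divr_gt0.
have [|K /(_ K (leqnn K)) KP] := @farther_complete _ _ _ _ DP (nfst c) (p i)
  (qadd (qpos (nsnd c)) (qpos (half_pow i))).
  rewrite qvalD !qval_pos qradius_half_pow; move: (cy); rewrite alphaE.
  have := cauchy_dist i px.
  have := metric_triangle y (nu (nfst c)) x.
  have := metric_triangle (nu (nfst c)) (nu (p i)) x.
  by rewrite [mdist y (nu _)]metric_sym; lra.
apply/sigma_setP; exists (npair (npair c i) K), c; split=> //.
by rewrite /singleton_name !npairE KP.
Qed.

Lemma N_to_M (deltaY : naming (set X)) :
  N_computable nu deltaY -> M_computable nu deltaY.
Proof.
move=> /mv_computableE[c cP]; apply/mv_computableE.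
(* The name of [U] is kept as it is, for it also names the closed complement of [U]. *)
pose M r := bpair (bpair (singleton_name (evens (evens r))) (odds (evens r))) (odds r).
have [|d dP] := @cin_relativize baire id (fun r _ => M r) c.
  by rewrite /M /bpair /singleton_name /evens /odds; cin_auto.
have [e eP] := cin_npair (@cin_const _ id 0%N) (@cin_id baire id).
exists (CComp d e) => _ [[x U] Y] [_ [q [-> [p [u [-> px pU]]] qY]]] /= Ux.
have [||qNM [cq [[V W] [VW [AV BW VW0 YVW]]]]] :=
  cP (M (bpair (bpair p u) q)) (([set x], ~` U), Y).
- rewrite /M !(evens_bpair, odds_bpair).
  exists (bpair (singleton_name p) u), q; split=> //.
  exists (singleton_name p), u; split=> //.
    by exists (~` [set x]); [rewrite -(singleton_nameP px)|rewrite setCK].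
  by exists U.
- by rewrite /=; apply/seteqP; split=> // y [/= ->].
exists qNM; split.
  by move=> n; exists (npair 0 n); split; [exact: (eP (bpair (bpair p u) q))|exact: dP].
exists (V, W); split=> //; split=> //; first exact: AV.
(* [W] contains the complement of [U] and misses [V], so [V] lies in [U]. *)
move=> y Vy; apply: contrapT => nUy.
have : (V `&` W) y by split=> //; exact: BW.
by rewrite VW0.
Qed.

End CauchyNames.

(** * From M to B: words of ideal points *)

(** Determinism lets a run of the realizer be compared with the output chosen for another name with
    the same prefix. *)
Lemma peval_inj p c n m m' : peval p c n m -> peval p c n m' -> m = m'.
Proof.
elim: c n m m' => [||||||||].
1-5: by move=> n m m' -> ->.
- move=> c IHc d IHd n m m' [a [b [ca db ->]]] [a' [b' [ca' db' ->]]].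
  by rewrite (IHc _ _ _ ca ca') (IHd _ _ _ db db').
- move=> c IHc d IHd n m m' [a [da cm]] [a' [da' cm']].
  by rewrite (IHd _ _ _ da da') in cm; exact: IHc cm cm'.
- move=> c IHc d IHd n m m' [s [s0 sS ->]] [s' [s'0 s'S ->]].
  suff: forall i, (i <= nsnd n)%N -> s i = s' i by apply.
  elim=> [|i IH] li; first exact: IHc s0 s'0.
  by have := sS i li; rewrite (IH (ltnW li)) => /IHd; apply; exact: s'S.
- move=> c IHc n m m' [cm ltm] [cm' ltm'].
  case: (ltngtP m m') => // [/ltm'|/ltm] [v cv].
    by have := IHc _ _ _ cm cv.
  by have := IHc _ _ _ cm' cv.
Qed.

Lemma word_exists (p : baire) n :
  exists w, forall i, (i <= n)%N -> nfst (iter i nsnd w) = p i.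
Proof.
elim: n p => [|n IH] p.
  by exists (npair (p 0%N) 0) => -[|//] _; rewrite nfst_npair.
have [w wP] := IH (fun i => p i.+1); exists (npair (p 0%N) w) => -[|i] li.
  by rewrite nfst_npair.
by rewrite iterSr nsnd_npair wP.
Qed.

Section PointsToBasis.
Local Open Scope ring_scope.
Context (R : realType) (X : metricType R) (nu : nat -> X) (D : nat -> nat).
Hypothesis DP : forall i j k,
  `|mdist (nu i) (nu j) - qval R (D (npair (npair i j) k))| <= 2 ^- k.
Hypothesis cD : computable_nat D.
Hypothesis nu_dense : dense (range nu).

Definition word_name (w n : nat) : baire := fun i => nfst (iter (minn i n) nsnd w).

(* At precision [k], the word of length [n.+1] coded by [w] prolongs to a Cauchy
   name of its last ideal point, which lies in the ideal ball [b]. *)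
Definition valid_word (w n b k : nat) : bool :=
  all (fun i => all (fun j =>
      closer D (word_name w n i) (word_name w n j) (qpos (half_pow (minn i j))) k)
    (iota 0 n.+1)) (iota 0 n.+1) &&
  closer D (nfst b) (word_name w n n) (qpos (nsnd b)) k.

(** The name is constant from [n] on, so the finitely many tested bounds imply all Cauchy bounds. *)
Lemma valid_word_sound w n b k : valid_word w n b k ->
  cauchy_naming nu (word_name w n) (nu (word_name w n n)) /\
  alpha nu b (nu (word_name w n n)).
Proof.
move=> /andP[/allP sC /(closer_sound DP)]; rewrite qval_pos => bn.
split; last by rewrite alphaE.
have const i : (n <= i)%N -> word_name w n i = word_name w n n.
  by move=> ni; rewrite /word_name minnn (minn_idPr ni).
split.
  by apply: cvg_near_cst; exists n => // i /= ni; rewrite const.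
have close i j : (i <= n)%N -> (j <= n)%N ->
    mdist (nu (word_name w n i)) (nu (word_name w n j)) < 2 ^- minn i j.
  move=> li lj; rewrite -(qradius_half_pow R) -qval_pos.
  apply: (closer_sound DP (k := k)).
  have := sC i; rewrite mem_iota leq0n add0n ltnS => /(_ li) /allP; apply.
  by rewrite mem_iota leq0n add0n ltnS.
move=> i j; case: (leqP i n) => [li|/ltnW ni]; case: (leqP j n) => [lj|/ltnW nj].
- exact: close.
- rewrite (const j) // (minn_idPl (leq_trans li nj)).
  by have := close i n li (leqnn n); rewrite (minn_idPl li).
- rewrite (const i) // (minn_idPr (leq_trans lj ni)).
  by have := close n j (leqnn n) lj; rewrite (minn_idPr lj).
- by rewrite (const i) // (const j) // mdistxx invr_gt0 exprn_gt0.
Qed.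

(** Validity consists of finitely many strict inequalities, each confirmed from some precision
    on. *)
Lemma valid_word_complete (p : baire) w n b :
    (forall i, (i <= n)%N -> word_name w n i = p i) ->
    (forall i j, mdist (nu (p i)) (nu (p j)) < 2 ^- minn i j) ->
    alpha nu b (nu (p n)) ->
  exists k, valid_word w n b k.
Proof.
move=> wp pC; rewrite alphaE => pb.
have [|K1 K1P] := @bounded_choice n.+1 (fun i k => forall j, (j < n.+1)%N ->
    closer D (word_name w n i) (word_name w n j) (qpos (half_pow (minn i j))) k).
  move=> i li; apply: bounded_choice => j lj; apply: (closer_complete DP).
  by rewrite qval_pos qradius_half_pow !wp.
have [|K2 K2P] := @closer_complete _ _ _ _ DP (nfst b)
   (word_name w n n) (qpos (nsnd b)).
  by rewrite qval_pos wp.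
exists (maxn K1 K2); rewrite /valid_word K2P ?leq_maxr // andbT.
apply/allP => i; rewrite mem_iota add0n => /andP[_ li].
apply/allP => j; rewrite mem_iota add0n => /andP[_ lj].
by apply: K1P => //; exact: leq_maxl.
Qed.

Lemma fast_name x : exists p : baire, cauchy_naming nu p x.
Proof.
(* The extra factor 1/2 pays for the triangle inequality between two approximations of [x]. *)
have /choice[p pP] : forall i : nat, exists a, mdist (nu a) x < 2 ^- i.+1.
  by move=> i; apply: (dense_point nu_dense); rewrite invr_gt0 exprn_gt0.
have pow_le (i j : nat) : (i <= j)%N -> 2 ^- j.+1 <= 2 ^- i.+1 :> R.
  by move=> ij; rewrite lef_pV2 ?posrE ?exprn_gt0 // ler_eXn2l // ltr1n.
exists p; split.
  apply/metricType_numDomainType.cvgrPdist_lt => e e0.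
  have [K KP] := half_pow_small e0; exists K => // i /= Ki.
  by rewrite metric_sym (lt_trans (pP i)) // KP // ltnW.
move=> i j; apply: le_lt_trans (metric_triangle _ x _) _.
rewrite [mdist x _]metric_sym; have := pP i; have := pP j.
have := pow_le _ _ (geq_minl i j); have := pow_le _ _ (geq_minr i j).
suff -> : 2 ^- minn i j = 2 ^- (minn i j).+1 + 2 ^- (minn i j).+1 :> R by lra.
by rewrite exprS invfM; lra.
Qed.

Lemma M_to_B (deltaY : naming (set X)) :
  M_computable nu deltaY -> B_computable nu deltaY.
Proof.
move=> /mv_computableE[c cP].
(* A basis index codes (((w, n), b), k): a word, its last position, an ideal ball and a
   precision. *)
pose w t := nfst (nfst (nfst t)); pose len t := nsnd (nfst (nfst t)).
pose b t := nsnd (nfst t); pose valid t := valid_word (w t) (len t) (b t) (nsnd t).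
pose r (p : baire) t := bpair (bpair (word_name (w t) (len t)) (fun=> (b t).+1)) p.
pose I := {z : baire * set X | deltaY z.1 z.2 /\ mvdom (opB nu) z.2}.
pose o (i : I) := (sval i).1; pose Y (i : I) := (sval i).2.
have nameM p x e y (pY : baire) : cauchy_naming nu p x -> deltaY pY y ->
    prod_naming (prod_naming (cauchy_naming nu) (sigma01 nu)) deltaY
      (bpair (bpair p (fun=> e.+1)) pY) (x, alpha nu e, y).
  move=> px py; exists (bpair p (fun=> e.+1)), pY; split=> //.
  exists p, (fun=> e.+1); split=> //.
  apply/seteqP; split=> z; first by move=> ez; exists 0%N.
  by move=> [j].
(* Halting is guaranteed for valid codes only; elsewhere the choice is arbitrary. *)
have /choice[Q QP] : forall z : I * nat, exists q : baire, valid z.2 ->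
    (forall m, peval (r (o z.1) z.2) c m (q m)) /\
    exists VW, prod_naming (sigma01 nu) (sigma01 nu) q VW /\
      mvval (opM X) (nu (word_name (w z.2) (len z.2) (len z.2)),
                     alpha nu (b z.2), Y z.1) VW.
  move=> [i t] /=; case: (boolP (valid t)) => [vt|_]; last by exists id.
  have [sC sb] := valid_word_sound vt.
  by have [q ?] := cP _ _ (nameM _ _ (b t) _ _ sC (svalP i).1) sb; exists q.
(* Invalid codes yield the empty set and the whole space: the constant 0 lists no ball, [succn]
   lists all of them. *)
pose Q' i t : baire := fun m =>
  if valid t then Q (i, t) m else bpair (fun=> 0%N) succn m.
pose U i t := sigma_set nu (evens (Q' i t)); pose V i t := sigma_set nu (odds (Q' i t)).
have UVP i t : [/\ U i t `<=` alpha nu (b t), U i t `&` V i t = set0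
    & Y i `<=` U i t `|` V i t].
  rewrite /U /V /Q'; case: (boolP (valid t)) => [vt|_].
    have [_ [[U' V'] [[u [v [QE uU vV]]] [_ UV UV0 YUV]]]] := QP (i, t) vt.
    rewrite -[X in evens X]/(Q (i, t)) -[X in odds X]/(Q (i, t)) QE.
    rewrite evens_bpair odds_bpair.
    by rewrite -[sigma_set nu u]uU -[sigma_set nu v]vV.
  rewrite evens_bpair odds_bpair.
  have -> : sigma_set nu (fun=> 0%N) = set0 by rewrite -subset0 => x [].
  split; rewrite ?set0I // => y _; right; apply/sigma_setP.
  by have [e [ey _]] := small_alpha nu_dense y (ltr01); exists e, e.
pose out i := bpair (bomega (Q' i)) (bomega (fun t => bpair (fun=> t) (fun=> b t))).
apply: (@mv_computable_in _ _ _ _ _ out).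
  have cQ : computable_in o (fun i n => Q' i (nfst n) (nsnd n)).
    have cw f g h : computable_in o f -> computable_in o g -> computable_in o h ->
        computable_in o (fun i n => word_name (f i n) (g i n) (h i n)).
      by move=> cf cg ch; rewrite /word_name; cin_auto.
    apply: cin_lazy_if.
    - rewrite /valid /valid_word /w /len /b.
      apply: cin_and; last by cin_auto; do !(apply: cw); cin_auto.
      apply: cin_all; last by cin_auto.
      apply: cin_all; last by cin_auto.
      by cin_auto; do !(apply: cw); cin_auto.
    - by rewrite /bpair; cin_auto.
    have [|d dP] := @cin_relativize _ o (fun i t => r (o i) t) c.
      by rewrite /r /bpair /b; cin_auto; apply: cw; rewrite /w /len; cin_auto.
    exists d => i n vn; rewrite -{1}(npair_eta n); apply: dP.
    exact: (QP (i, nfst n) vn).1.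
  rewrite /out /bpair /bomega; apply: cin_if; first by cin_auto.
    by rewrite /b; cin_auto.
  apply: (@cin_ext _ _ (fun i n => Q' i (nfst (npair (nfst n./2) (nsnd n./2)))
      (nsnd (npair (nfst n./2) (nsnd n./2))))); first by move=> i n; rewrite !npairE.
  by apply: (cin_comp cQ); cin_auto.
move=> i; exists (fun t => (U i t, V i t), fun t => (t, b t)); split.
  exists (bomega (Q' i)), (bomega (fun t => bpair (fun=> t) (fun=> b t))); split=> //.
    exists (Q' i); split=> // t; exists (evens (Q' i t)), (odds (Q' i t)); split=> //.
    by apply/funext => n; rewrite /bpair /evens /odds; case: ifP => no;
      rewrite -[in LHS](odd_double_half n) no.
  by exists (fun t => bpair (fun=> t) (fun=> b t)); split=> // t;
    exists (fun=> t), (fun=> b t).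
(* On a Cauchy name [p] of [x], the realizer lists a ball around [x] as entry [j] of its first
   output, and this depends only on the first [L] oracle entries. A word of [p] that is long enough
   and ends inside ball [e] forces the same entry. *)
have cover e x : alpha nu e x -> exists t, U i t x /\ b t = e.
  move=> ex; have [p px] := fast_name x.
  have [q [cq [[V' W'] [[u [v [qE uV _]]] [V'x _ _ _]]]]] :=
    cP _ _ (nameM _ _ e _ _ px (svalP i).1) ex.
  have /sigma_setP[j [e' [uj e'x]]] : sigma_set nu u x by rewrite -[sigma_set nu u]uV.
  have [L LP] := peval_use (cq j.*2).
  have [n [Ln en]] : exists n, (L <= n)%N /\ alpha nu e (nu (p n)).
    have [K _ KP] := px.1 _ (open_nbhs_nbhs (conj (open_alpha nu e) ex)).
    by exists (maxn L K); split; [exact: leq_maxl|apply: KP; exact: leq_maxr].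
  have [w' w'P] := word_exists p n.
  have w'p m : (m <= n)%N -> word_name w' n m = p m.
    by move=> mn; rewrite /word_name (minn_idPl mn) w'P.
  have [k kP] := valid_word_complete w'p px.2 en.
  exists (npair (npair (npair w' n) e) k).
  set t := npair _ _; have [wt lt bt] : [/\ w t = w', len t = n & b t = e].
    by rewrite /w /len /b /t !npairE.
  have vt : valid t by rewrite /valid wt lt bt /t nsnd_npair.
  split=> //; apply/sigma_setP; exists j, e'; split=> //.
  rewrite -uj -(evens_bpair u v) -qE /evens /Q' vt.
  apply: peval_inj ((QP (i, t) vt).1 j.*2) _; apply: (LP n Ln) => m mn.
  (* The oracles can differ only in the Cauchy name, whose entry [m./2./2] sits at position [m];
     this index is at most [n], where the word follows [p]. *)
  rewrite /r wt lt bt /bpair; case: ifP => // _; case: ifP => // _.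
  by apply: w'p; apply: leq_trans (ltnW mn); rewrite -!divn2; lia.
split.
- split; first by move=> _ [t _ <-]; exact: open_sigma_set.
  move=> x O /(alpha_nbhs nu_dense)[e [ex eO]]; have [t [tx te]] := cover e x ex.
  exists (U i t); first by split=> //; exists t.
  by apply: subset_trans eO; have [+ _ _] := UVP i t; rewrite te.
- by move=> t; have [] := UVP i t.
- split; first by move=> t e [k [<- <-]]; have [] := UVP i k.
  move=> e x /cover[t [tx te]]; exists t; split=> //.
  by exists t; rewrite te.
Qed.

End PointsToBasis.

(** * From B to S: disjoint pieces of a cover *)

Section BasisToShrinking.
Local Open Scope ring_scope.
Context (R : realType) (X : metricType R) (nu : nat -> X) (D : nat -> nat).
Hypothesis DP : forall i j k,
  `|mdist (nu i) (nu j) - qval R (D (npair (npair i j) k))| <= 2 ^- k.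
Hypothesis cD : computable_nat D.
Hypothesis nu_dense : dense (range nu).

(* [w] codes a choice, for each [s < N], of a ball listed by [h s] in which [c]
   is formally included. *)
Definition inside_all (h : nat -> baire) (N c w k : nat) : bool :=
  all (fun s => (0 < h s (nfst (iter s nsnd w)))%N &&
    inside D c (h s (nfst (iter s nsnd w))).-1 k) (iota 0 N).

(** A finite intersection of enumerated open sets is exhausted by the ideal balls formally inside a
    listed ball of each; [w] and [k] are the witnesses that make the test decidable. *)
Lemma inside_allP (h : nat -> baire) N x :
  (forall s, (s < N)%N -> sigma_set nu (h s) x) <->
  exists c w k, inside_all h N c w k /\ alpha nu c x.
Proof.
split=> [hx|[c [w [k [/allP hN cx]]]] s sN]; last first.
  have := hN s; rewrite mem_iota leq0n add0n => /(_ sN) /andP[h0 /(inside_sound DP) hc].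
  by apply/sigma_setP; exists (nfst (iter s nsnd w)), (h s (nfst (iter s nsnd w))).-1;
    rewrite prednK //; split=> //; apply: hc.
have /choice[m mP] : forall s, exists m, (s < N)%N ->
    (0 < h s m)%N /\ alpha nu (h s m).-1 x.
  move=> s; case: (ltnP s N) => [/hx/sigma_setP[m [e [me ex]]]|_]; last by exists 0%N.
  by exists m; rewrite me.
have /choice[d dP] : forall s, exists d : R, 0 < d /\ ((s < N)%N ->
    forall c, alpha nu c x -> qradius R (nsnd c) < d ->
    exists K, forall k, (K <= k)%N -> inside D c (h s (m s)).-1 k).
  move=> s; case: (ltnP s N) => [/mP[_ /(inside_complete DP)[d d0 ?]]|_];
    last by exists 1.
  by exists d.
(* A single radius bound below the finitely many thresholds, with 1 for the empty minimum. *)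
pose e := \big[Num.min/1]_(s < N) d s.
have e0 : 0 < e by rewrite /e; elim/big_ind: _ => // [y z y0 z0|s _];
  [rewrite lt_min y0|exact: (dP s).1].
have ed s : (s < N)%N -> e <= d s.
  by move=> sN; rewrite /e (bigminD1 (Ordinal sN)) //= ge_min lexx.
have [c [cx ce]] := small_alpha nu_dense x e0.
have [w wP] := word_exists m N.
have [|k /(_ k (leqnn k)) kP] :=
    @bounded_choice N (fun s k => inside D c (h s (m s)).-1 k).
  by move=> s sN; apply: (dP s).2 => //; apply: lt_le_trans ce (ed s sN).
exists c, w, k; split=> //; apply/allP => s; rewrite mem_iota add0n => /andP[_ sN].
by rewrite wP ?(ltnW sN) // (mP s sN).1 kP.
Qed.

Lemma B_to_S (deltaY : naming (set X)) :
  B_computable nu deltaY -> S_computable nu deltaY.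
Proof.
move=> /mv_computableE[c cP].
pose I := {z : baire * ((nat -> set X) * set X) |
  prod_naming (pow_naming (sigma01 nu)) deltaY z.1 z.2 /\ mvdom (opS X) z.2}.
pose o (i : I) := (sval i).1.
have /choice[Q QP] : forall i : I, exists q : baire,
    (forall n, peval (odds (o i)) c n (q n)) /\ exists y,
      prod_naming (pow_naming (prod_naming (sigma01 nu) (sigma01 nu)))
        (pow_naming (prod_naming nat_naming nat_naming)) q y /\
      mvval (opB nu) (sval i).2.2 y.
  move=> i; apply: cP => //; have [[p [q [oE _ qY]]] _] := svalP i.
  by rewrite /o oE odds_bpair.
have cQ f : computable_in o f -> computable_in o (fun i n => Q i (f i n)).
  move=> cf; have [|d dP] := @cin_relativize _ o (fun i _ => odds (o i)) c.
    by rewrite /odds; cin_auto.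
  have [e eP] := cin_npair (@cin_const _ o 0) cf.
  exists (CComp d e) => i n; exists (npair 0 (f i n)); split=> //.
  exact: dP ((QP i).1 _).
(* The even half of [Q i] holds the basis, and even and odd entries of its [k]-th component name U_k
   and V_k. The odd half holds the relation, with the [k]-th pair at positions 0 and 1 of its
   component. *)
pose u i k : baire := fun n => Q i (npair k n.*2).*2.
pose v i k : baire := fun n => Q i (npair k n.*2.+1).*2.
pose a i k := Q i (npair k 0).*2.+1; pose b i k := Q i (npair k 1).*2.+1.
have QE i : exists (UV : nat -> set X * set X) (ab : nat -> nat * nat),
    mvval (opB nu) (sval i).2.2 (UV, ab) /\
    forall k, [/\ (UV k).1 = sigma_set nu (u i k), (UV k).2 = sigma_set nu (v i k)
      & ab k = (a i k, b i k)].
  have [_ [[UV ab] [[q [r [QE [P [qE uv]] [A [rE abA]]]] UVab]]]] := QP i.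
  exists UV, ab; split=> // k.
  have evQ n : Q i n.*2 = q n by rewrite -[LHS]/(evens (Q i) n) QE evens_bpair.
  have odQ n : Q i n.*2.+1 = r n by rewrite -[LHS]/(odds (Q i) n) QE odds_bpair.
  have [u' [v' [PE uE vE]]] := uv k.
  have [a' [b' [AE aE bE]]] := abA k.
  have -> : u i k = u'.
    apply/funext => n; rewrite /u evQ qE /bomega !npairE PE.
    by rewrite -[LHS]/(evens (bpair u' v') n) evens_bpair.
  have -> : v i k = v'.
    apply/funext => n; rewrite /v evQ qE /bomega !npairE PE.
    by rewrite -[LHS]/(odds (bpair u' v') n) odds_bpair.
  split; [exact: uE|exact: vE|].
  by rewrite /a /b !odQ rE /bomega !npairE AE /bpair /= aE bE -surjective_pairing.
pose entry i j m := o i (npair j m).*2.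
(* [t] codes a set index [j], an entry [m] of its name and an index [k] into the
   refined inclusion; if the entry is the ball [b i k], the basic set with index
   [a i k] refines the [j]-th set. *)
pose row t := nfst (nfst t); pose idx t := nsnd t.
pose active i t := entry i (row t) (nsnd (nfst t)) == (b i (idx t)).+1.
(* Names of the sets whose intersection over [s <= t] is the [t]-th piece. *)
pose h i t s : baire := fun m =>
  if active i s then
    if s == t then u i (a i (idx s)) m else v i (a i (idx s)) m
  (* An inactive [s < t] imposes no condition, as [m.+1] lists all balls, while an inactive [t]
     makes its own piece empty. *)
  else if s == t then 0%N else m.+1.
(* A position codes ((t, e), (w, k)); ball [e] is emitted once it is certified to lie in every
   factor of piece [t] and [t] belongs to row [j]. *)
pose out i j : baire := fun z =>
  let t := nfst (nfst z) in let e := nsnd (nfst z) in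
  if (row t == j) && inside_all (h i t) t.+1 e (nfst (nsnd z)) (nsnd (nsnd z))
  then e.+1 else 0%N.
have outP i j x : sigma_set nu (out i j) x <->
    exists t, row t = j /\ forall s, (s < t.+1)%N -> sigma_set nu (h i t s) x.
  split.
    move=> /sigma_setP[z [e []]]; rewrite /out.
    case: ifP => // /andP[/eqP tj ins] [<-] ex.
    exists (nfst (nfst z)); split=> //; apply/inside_allP.
    by exists (nsnd (nfst z)), (nfst (nsnd z)), (nsnd (nsnd z)).
  move=> [t [tj /inside_allP[e [w [k [ins ex]]]]]].
  apply/sigma_setP; exists (npair (npair t e) (npair w k)), e; split=> //.
  by rewrite /out !npairE tj eqxx ins.
apply: (@mv_computable_in _ _ _ _ _ (fun i => bomega (out i))).
  have ca f : computable_in o f -> computable_in o (fun i n => a i (f i n)).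
    by move=> cf; rewrite /a; apply: cQ; cin_auto.
  have cu f g : computable_in o f -> computable_in o g ->
      computable_in o (fun i n => u i (f i n) (g i n)).
    by move=> cf cg; rewrite /u; apply: cQ; cin_auto.
  have cv f g : computable_in o f -> computable_in o g ->
      computable_in o (fun i n => v i (f i n) (g i n)).
    by move=> cf cg; rewrite /v; apply: cQ; cin_auto.
  have cactive f : computable_in o f -> computable_in o (fun i n => active i (f i n)).
    move=> cf; rewrite /active /entry /b /row /idx; apply: cin_eq; first by cin_auto.
    by apply: cin_succ; apply: cQ; cin_auto.
  have ch f g m : computable_in o f -> computable_in o g -> computable_in o m ->
      computable_in o (fun i n => h i (f i n) (g i n) (m i n)).
    move=> cf cg cm; rewrite /h /idx; apply: cin_if; first exact: cactive.
      by apply: cin_if; [cin_auto|apply: cu => //; apply: ca; cin_auto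
                                |apply: cv => //; apply: ca; cin_auto].
    by cin_auto.
  rewrite /bomega /out; apply: cin_if; [|by cin_auto|by cin_auto].
  rewrite /row; apply: cin_and; first by cin_auto.
  rewrite /inside_all; apply: cin_all; last by cin_auto.
  apply: cin_and; first by apply: cin_leq; [cin_auto|apply: ch; cin_auto].
  by apply: cin_inside => //; try apply: cin_pred; try apply: ch; cin_auto.
move=> i; have [UV [ab [[basU UVY [refL refR]] uvab]]] := QE i.
have [[p [q [oE [vs [pE vsV]] _]]] YV] := svalP i.
have entryE j m : entry i j m = vs j m.
  rewrite /entry -[LHS]/(evens (o i) (npair j m)).
  by rewrite (oE : o i = _) evens_bpair pE /bomega !npairE.
have hU t x : sigma_set nu (h i t t) x -> active i t /\ (UV (a i (idx t))).1 x.
  have [-> _ _] := uvab (a i (idx t)).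
  move=> /sigma_setP[m [e []]]; rewrite /h eqxx; case: ifP => // _ um ex.
  by split=> //; apply/sigma_setP; exists m, e.
have hV t s x : s != t -> active i s -> sigma_set nu (h i t s) x ->
    (UV (a i (idx s))).2 x.
  have [_ -> _] := uvab (a i (idx s)).
  move=> /negPf st si /sigma_setP[m [e []]]; rewrite /h st si => um ex.
  by apply/sigma_setP; exists m, e.
exists (fun j => sigma_set nu (out i j)); split; first by exists (out i).
rewrite [X in mvdom _ X]surjective_pairing in YV.
rewrite [X in mvval _ X]surjective_pairing; split.
(* Piece [t] lies in its basic set, which the relation places inside ball [b i (idx t)]; activity
   says that this ball is listed for the [j]-th set. *)
- move=> j x /outP[t [tj /(_ t (ltnSn t))/hU[/eqP ti Ux]]].
  rewrite (vsV j); apply/sigma_setP; exists (nsnd (nfst t)), (b i (idx t)).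
  rewrite -tj -entryE ti; split=> //; apply: refL Ux.
  by exists (idx t); have [_ _] := uvab (idx t).
- move=> y Yy; have [j _] := YV y Yy; rewrite (vsV j) => /sigma_setP[m [e [me ey]]].
  have [a' [Uy [k kE]]] := refR e y ey.
  have [_ _] := uvab k; rewrite kE => -[a'E eE].
  pose P t := active i t && `[< (UV (a i (idx t))).1 y >].
  have exP : exists t, P t.
    exists (npair (npair j m) k).
    rewrite /P /active /row /idx !npairE entryE me eE eqxx.
    by rewrite -a'E; apply/asboolP.
  (* By minimality [y] avoids the basic set of every earlier active [s], so it lies in the
     complementary open set, because the two cover [Y]. *)
  case: (ex_minnP exP) => t /andP[ti /asboolP Uty] tmin.
  exists (row t) => //; apply/outP; exists t; split=> // s; rewrite ltnS => st.
  have [[uE _ _] [_ vE _]] := (uvab (a i (idx t)), uvab (a i (idx s))).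
  have [sEt|sNt] := eqVneq s t.
    move: Uty; rewrite uE => /sigma_setP[n [e' [un e'y]]].
    by apply/sigma_setP; exists n, e'; rewrite /h sEt eqxx ti.
  case: (boolP (active i s)) => si; last first.
    have [e' [e'y _]] := small_alpha nu_dense y ltr01.
    by apply/sigma_setP; exists e', e'; rewrite /h (negPf si) (negPf sNt).
  have [_ /(_ y Yy)[Usy|]] := UVY (a i (idx s)).
    have : (t <= s)%N by apply: tmin; rewrite /P si; apply/asboolP.
    by move=> ts; rewrite eqn_leq st ts in sNt.
  rewrite vE => /sigma_setP[n [e' [vn e'y]]].
  by apply/sigma_setP; exists n, e'; rewrite /h si (negPf sNt).
apply/trivIsetP => j j' _ _ jj'; rewrite -subset0.
move=> x [/outP[t [tj tx]] /outP[t' [tj' tx']]].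
(* The earlier piece lies in its own U and the later one in the V paired with it, and these are
   disjoint. *)
have disj s s' : (s < s')%N ->
    sigma_set nu (h i s s) x -> sigma_set nu (h i s' s) x -> False.
  move=> ss' /hU[si Ux] /hV; rewrite neq_ltn ss' => /(_ isT si) Vx.
  by have [+ _] := UVY (a i (idx s)) => /seteqP[/(_ x) + _]; apply.
case: (ltngtP t t') => [lt|lt|tt'].
- by apply: (disj _ _ lt); [exact: tx|apply: tx'; exact: ltnW].
- by apply: (disj _ _ lt); [exact: tx'|apply: tx; exact: ltnW].
- by move: jj'; rewrite -tj -tj' tt' eqxx.
Qed.

End BasisToShrinking.

Theorem proposition4p1 (R : realType) (X : metricType R) (nu : nat -> X)
  (hX : computable_metric_space nu)
  (YY : set (set X))
  (hYY : forall Y : set X, YY Y -> zero_dimensional_set Y \/ Y = set0)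
  (deltaY : naming (set X)) (hdeltaY : is_representation YY deltaY) :
  (N_computable nu deltaY -> M_computable nu deltaY) /\
  (M_computable nu deltaY -> B_computable nu deltaY) /\
  (B_computable nu deltaY -> S_computable nu deltaY).
Proof.
have [nu_dense [D cD DP]] := hX.
split; first exact: N_to_M DP cD nu_dense _.
by split; [exact: M_to_B DP cD nu_dense _|exact: B_to_S DP cD nu_dense _].
Qed.
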